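(* Let $F:\mathbb{R}^d\to\mathbb{R}^d$ be smooth. A locally exact modification of the implicit Euler scheme for $\dot x=F(x)$ is given either by $$x_{n+1}=x_n+\bigl(I-e^{-h_nF'(x_n)}\bigr)\bigl(F'(x_n)\bigr)^{-1}F(x_{n+1}),$$ or by $$x_{n+1}=x_n+\bigl(I-e^{-h_nF'(x_{n+1})}\bigr)\bigl(F'(x_{n+1})\bigr)^{-1}F(x_{n+1}).$$ That is, both schemes are of the form $x_{n+1}-x_n=\delta(\bar x_n,h_n)F(x_{n+1})$ with $\delta(\bar x,h)=\bigl(I-e^{-hF'(\bar x)}\bigr)\bigl(F'(\bar x)\bigr)^{-1}$, where $\bar x_n=x_n$ in the first case and $\bar x_n=x_{n+1}$ in the second case, and each is locally exact at the corresponding $\bar x_n$ for every $n$.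
   Context: Notation: $F'$ is the Jacobi matrix of $F$; $h_n>0$ is the time step; $\varphi_1(z)=(e^z-1)/z$, $\varphi_1(0)=1$. For a matrix $A$ the expression $(I-e^{-hA})A^{-1}$ is understood as $h\varphi_1(-hA)$, so it makes sense also for singular $A$. The implicit Euler scheme is $x_{n+1}-x_n=h_nF(x_{n+1})$; a modification of it is obtained by replacing $h_n$ by a matrix $\delta(\bar x_n,h_n)$ with $\lim_{h\to0}\delta(\bar x_n,h)/h=I$. Local exactness. Consider a one-step scheme (explicit or implicit) for $\dot x=F(x)$ whose coefficients may depend on a point $\bar x$ treated as a fixed parameter. The linearization of the scheme around $\bar x$ is obtained by substituting $x_n=\bar x+\nu_n$, $x_{n+1}=\bar x+\nu_{n+1}$ (with $\bar x$ held fixed, in particular in $\delta(\bar x,h_n)$) and keeping only terms of order at most one in $(\nu_n,\nu_{n+1})$. The linearization of the differential equation around $\bar x$ is $\dot\nu=F'(\bar x)\nu+F(\bar x)$, with $\nu=x-\bar x$; its exact discretization (the difference equation whose solution satisfies $\nu_n=\nu(t_n)$) is $\nu_{n+1}=e^{h_nF'(\bar x)}\nu_n+h_n\varphi_1(h_nF'(\bar x))F(\bar x)$. The scheme is locally exact at $\bar x$ if its linearization around $\bar x$, solved for $\nu_{n+1}$, is identical with this exact discretization. A scheme is locally exact if there is a sequence $\bar x_n$ with $\bar x_n-x_n=O(h_n)$ such that the scheme is locally exact at $\bar x_n$ for every $n$; the point $\bar x_n$ may be chosen depending on $x_n,x_{n+1}$, the choice being made after the linearization with $\bar x_n$ fixed.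 *)

(* Defs.v *)
From HB Require Import structures.
From mathcomp Require Import all_boot all_order all_algebra.
From mathcomp Require Import all_classical all_reals all_analysis.
Set Implicit Arguments.
Unset Strict Implicit.
Unset Printing Implicit Defensive.
Import Order.TTheory GRing.Theory Num.Theory.
Import numFieldNormedType.Exports.
Local Open Scope classical_set_scope.
Local Open Scope ring_scope.

Section Smoothness.
Context {R : realType} {d : nat}.

Fixpoint Ck (k : nat) (F : 'cV[R]_d -> 'cV[R]_d) : Prop :=
  match k with
  | 0 => continuous F
  | k'.+1 => (forall x, differentiable F x) /\
             (forall j : 'I_d, Ck k' ('D_(delta_mx j ord0) F))
  end.

Definition smooth (F : 'cV[R]_d -> 'cV[R]_d) : Prop := forall k, Ck k F.

(* The library's [jacobian] acts on row vectors, hence is the transpose of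
   the matrix of partial derivatives below. *)
Definition jacobi (F : 'cV[R]_d -> 'cV[R]_d) (x : 'cV[R]_d) : 'M[R]_d :=
  \matrix_(i, j) 'D_(delta_mx j ord0) (fun y => F y i ord0) x.

End Smoothness.

Section MatrixFunctions.
Context {R : realType} {d : nat}.
Implicit Types A : 'M[R]_d.

Definition expm A : 'M[R]_d :=
  limn (series (fun k => (k`!%:R)^-1 *: A ^+ k)).

(* The matrix function of the entire function (e^z - 1)/z, whose power series
   is the sum of the z^k/(k+1)!. *)
Definition phi1m A : 'M[R]_d :=
  limn (series (fun k => ((k.+1)`!%:R)^-1 *: A ^+ k)).

(* (I - e^(-hA)) A^-1, also for singular A; see one_sub_exp_divE. *)
Definition one_sub_exp_div (h : R) A : 'M[R]_d := h *: phi1m (- (h *: A)).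

Lemma cvg_mx_entries (p q : nat) (u : nat -> 'M[R]_(p, q)) (L : 'M[R]_(p, q)) :
  (forall i j, (fun n => u n i j) @ \oo --> L i j) -> u @ \oo --> L.
Proof.
move=> uL A [P PL sPA].
have : \forall n \near \oo, forall i j, P i j (u n i j).
  apply: (@filter_forall _ _ (fun i n => forall j, P i j (u n i j))) => i.
  apply: (@filter_forall _ _ (fun j n => P i j (u n i j))) => j.
  exact: (uL i j _ (PL i j)).
by apply: filterS => n /= nP; exact: sPA.
Qed.

Lemma cvg_entry (p q : nat) (u : nat -> 'M[R]_(p, q)) (L : 'M[R]_(p, q)) i j :
  u @ \oo --> L -> (fun n => u n i j) @ \oo --> L i j.
Proof.
move=> uL; have := @coord_continuous R p q i j L.
exact: (cvg_comp u (fun M : 'M[R]_(p, q) => M i j) uL).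
Qed.

Lemma series_mxE (u : nat -> 'M[R]_d) n i j :
  series u n i j = series (fun k => u k i j) n.
Proof. by rewrite /series /= summxE. Qed.

Lemma expmx_entry_le A k i j :
  `|(A ^+ k) i j| <= (d%:R * `|A|) ^+ k.
Proof.
elim: k i j => [|k IH] i j.
  by rewrite !expr0 mxE; case: (i == j); rewrite ?normr1 ?normr0.
rewrite exprSr mxE (le_trans (ler_norm_sum _ _ _))//.
have -> : (d%:R * `|A|) ^+ k.+1 = \sum_(l < d) (d%:R * `|A|) ^+ k * `|A|.
  by rewrite sumr_const card_ord exprSr -mulrnAr mulr_natl.
apply: ler_sum => l _; rewrite normrM ler_pM//.
rewrite [leRHS]/Num.Def.normr /= mx_normrE; apply/bigmax_geP; right => /=.
by exists (l, j).
Qed.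

Lemma is_cvg_mx_series (c : nat -> R) A :
  (forall k, `|c k| <= (k`!%:R)^-1) -> cvgn (series (fun k => c k *: A ^+ k)).
Proof.
move=> c_le.
have entry i j : cvgn (series (fun k => (c k *: A ^+ k) i j)).
  apply: normed_cvg.
  apply: (@series_le_cvg _ _ (exp_coeff (d%:R * `|A|))) => //.
  - by move=> k /=.
  - by move=> k; apply: exp_coeff_ge0; rewrite mulr_ge0.
  - by move=> k /=; rewrite mxE normrM mulrC ler_pM// expmx_entry_le.
  - exact: is_cvg_series_exp_coeff.
apply/cvg_ex; exists (\matrix_(i, j)
  (limn (series (fun k => (c k *: A ^+ k) i j)) : R)).
apply: cvg_mx_entries => i j; rewrite mxE.
by under eq_fun do rewrite series_mxE; exact: entry.
Qed.

Lemma is_cvg_expm A : cvgn (series (fun k => (k`!%:R)^-1 *: A ^+ k)).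
Proof. by apply: is_cvg_mx_series => k; rewrite ger0_norm// invr_ge0. Qed.

Lemma is_cvg_phi1m A : cvgn (series (fun k => ((k.+1)`!%:R)^-1 *: A ^+ k)).
Proof.
apply: is_cvg_mx_series => k; rewrite ger0_norm ?invr_ge0//.
by rewrite lef_pV2 ?posrE ?ltr0n ?fact_gt0// ler_nat factS leq_pmull.
Qed.

Lemma phi1mE A : phi1m A *m A = expm A - 1%:M.
Proof.
pose e := series (fun k => (k`!%:R : R)^-1 *: A ^+ k).
pose p := series (fun k => ((k.+1)`!%:R : R)^-1 *: A ^+ k).
have pA n : p n *m A = e n.+1 - 1%:M.
  rewrite /p /e /series /= big_nat_recl// fact0 invr1 scale1r expr0.
  rewrite addrAC subrr add0r mulmx_suml; apply: eq_bigr => k _.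
  by rewrite -scalemxAl exprSr.
have cvpA : (fun n => p n *m A) @ \oo --> phi1m A *m A.
  apply: cvg_mx_entries => i j; rewrite mxE.
  under eq_fun do rewrite mxE.
  apply: cvg_big => [|l _]; first exact: add_continuous.
  apply: cvgMr_tmp.
  by apply: cvg_entry; exact: is_cvg_phi1m.
have cve : (fun n => p n *m A) @ \oo --> expm A - 1%:M.
  under eq_fun do rewrite pA.
  apply: cvgB; last exact: cvg_cst.
  by rewrite (cvg_shiftS e); exact: is_cvg_expm.
exact: (cvg_unique _ cvpA cve).
Qed.

Lemma one_sub_exp_divE (h : R) A : A \in unitmx ->
  one_sub_exp_div h A = (1%:M - expm (- (h *: A))) *m invmx A.
Proof.
move=> uA; rewrite -[LHS](mulmxK uA); congr (_ *m _).
have := phi1mE (- (h *: A)).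
rewrite mulmxN -scalemxAr /one_sub_exp_div -scalemxAl => /(congr1 -%R).
by rewrite opprK opprB.
Qed.

End MatrixFunctions.

Section LocalExactness.
Context {R : realType} {d : nat}.
Local Notation V := 'cV[R]_d.

(* [S xbar h x y] is the residual (left-hand side minus right-hand side) of a
   possibly implicit one-step scheme with parameter xbar, step h, and
   x = x_n, y = x_{n+1}; the scheme is the equation [S xbar h x y = 0]. *)
Definition scheme := V -> R -> V -> V -> V.

(* Taylor polynomial of degree one, in (mu, nu) = (nu_n, nu_{n+1}), of the
   residual at x_n = xbar + mu, x_{n+1} = xbar + nu, with the parameter xbar
   held fixed. *)
Definition linearization (S : scheme) (xbar : V) (h : R) (mu nu : V) : V :=
  S xbar h xbar xbar +
  'd (fun p : V * V => S xbar h p.1 p.2) (xbar, xbar) (mu, nu).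

(* One step of the exact discretization of nu' = F'(xbar) nu + F(xbar). *)
Definition exact_step (F : V -> V) (xbar : V) (h : R) (mu : V) : V :=
  expm (h *: jacobi F xbar) *m mu
  + h *: (phi1m (h *: jacobi F xbar) *m F xbar).

(* The equivalence says that the linearized equation can be solved for
   nu_{n+1} and that its solution is the exact step. *)
Definition locally_exact_at (F : V -> V) (S : scheme) (xbar : V) (h : R) :
    Prop :=
  differentiable (fun p : V * V => S xbar h p.1 p.2) (xbar, xbar) /\
  forall mu nu : V,
    linearization S xbar h mu nu = 0 <-> nu = exact_step F xbar h mu.

(* x_0, ..., x_N is produced by the scheme with positive steps
   h_0, ..., h_{N-1}, where xbar_n = choice x_n x_{n+1}. Finite runs are
   considered since an implicit scheme need not be solvable forever. *)
Definition run (S : scheme) (choice : V -> V -> V) (N : nat)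
    (h : nat -> R) (x : nat -> V) : Prop :=
  forall n, (n < N)%N ->
    0 < h n /\ S (choice (x n) (x n.+1)) (h n) (x n) (x n.+1) = 0.

(* The first clause is xbar_n - x_n = O(h_n): the constant is uniform over
   all n and all runs that stay in a fixed ball with steps bounded by a fixed
   H. In the second clause x need not be a run, as local exactness at a point
   is a property of the scheme and of that point alone. *)
Definition locally_exact (F : V -> V) (S : scheme) (choice : V -> V -> V) :
    Prop :=
  (forall r H : R, exists C : R, forall N h x,
     run S choice N h x ->
     (forall n, (n <= N)%N -> `|x n| <= r) ->
     (forall n, (n < N)%N -> h n <= H) ->
     forall n, (n < N)%N ->
       `|choice (x n) (x n.+1) - x n| <= C * h n) /\
  (forall h x, (forall n, 0 < h n) ->
     forall n, locally_exact_at F S (choice (x n) (x n.+1)) (h n)).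

Definition step_modification (delta : V -> R -> 'M[R]_d) : Prop :=
  forall xbar : V, h^-1 *: delta xbar h @[h --> 0^'] --> (1%:M : 'M[R]_d).

Definition modified_implicit_euler (F : V -> V) (delta : V -> R -> 'M[R]_d) :
    scheme :=
  fun xbar h x y => (y - x) - delta xbar h *m F y.

End LocalExactness.

(* Main.v *)
Require Import Defs.
From HB Require Import structures.
From mathcomp Require Import all_boot all_order all_algebra.
From mathcomp Require Import ring.
From mathcomp Require Import all_classical all_reals all_analysis.
Set Implicit Arguments.
Unset Strict Implicit.
Unset Printing Implicit Defensive.
Import Order.TTheory GRing.Theory Num.Theory.
Import numFieldNormedType.Exports.
Local Open Scope classical_set_scope.
Local Open Scope ring_scope.

(** Write A = F'(xbar) and D = (I - e^(-hA)) A^-1 = h phi_1(-hA).  At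
    x_n = xbar + mu, x_(n+1) = xbar + nu the residual of the scheme is
    nu - mu - D F(xbar + nu), so its linearization is the equation
      nu - D A nu = mu + D F(xbar).
    Since z phi_1(-z) = 1 - e^(-z), we have D A = I - e^(-hA)
    ([one_sub_exp_div_mul]) and the equation reads
    e^(-hA) nu = mu + D F(xbar).  Multiplying by e^(hA), the inverse of e^(-hA)
    ([expm_mulN]), and using e^z phi_1(-z) = phi_1(z) in the form
    e^(hA) D = h phi_1(hA) ([expm_mul_one_sub_exp_div]) gives exactly
      nu = e^(hA) mu + h phi_1(hA) F(xbar),
    the exact discretization.  This is [modified_euler_exact_at]; it holds at
    every point xbar, in particular at x_n and at x_(n+1).

    The identity e^z phi_1(-z) = phi_1(z) has to be proved for matrices that may
    be singular, so one cannot divide by A; it is obtained from a Cauchy product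
    of power series in A ([mx_cauchy_product], [expm_mul_phi1mN]).  That e^A and
    e^(-A) are inverse to each other then follows from it.

    The two remaining points are estimates.  Comparing the power series of phi_1
    with that of the exponential gives |phi_1(A) - I| <= e^(d|A|) - 1
    ([norm_phi1m_sub1_le]).  Hence D / h tends to I as h tends to 0.  It also
    gives |D| <= h e^(dh|A|); as F and F' are bounded on balls,
    x_(n+1) - x_n = D F(x_(n+1)) is O(h), which is what is required of the
    choice xbar_n = x_(n+1). *)

(** * Norm and topology of matrices *)

Section MatrixNorm.
Context {R : realType}.

Lemma mx_entry_le p q (A : 'M[R]_(p, q)) i j : `|A i j| <= `|A|.
Proof.
rewrite [leRHS]/Num.Def.normr /= mx_normrE; apply/bigmax_geP; right => /=.
by exists (i, j).
Qed.

Lemma mx_norm_le p q (A : 'M[R]_(p, q)) c :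
  0 <= c -> (forall i j, `|A i j| <= c) -> `|A| <= c.
Proof.
move=> c0 Ac; rewrite [leLHS]/Num.Def.normr /= mx_normrE.
by apply: bigmax_le => // -[i j] _ /=; exact: Ac.
Qed.

Lemma norm_mulmx_le p q r (A : 'M[R]_(p, q)) (B : 'M[R]_(q, r)) :
  `|A *m B| <= q%:R * `|A| * `|B|.
Proof.
apply: mx_norm_le => [|i j]; first by rewrite !mulr_ge0.
rewrite mxE (le_trans (ler_norm_sum _ _ _))//.
have -> : q%:R * `|A| * `|B| = \sum_(l < q) `|A| * `|B|.
  by rewrite sumr_const card_ord -mulrA mulr_natl.
by apply: ler_sum => l _; rewrite normrM ler_pM// mx_entry_le.
Qed.

Lemma norm_mx1_le d : `|1%:M : 'M[R]_d| <= 1.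
Proof.
apply: mx_norm_le => // i j.
by rewrite mxE; case: (i == j); rewrite ?normr1 ?normr0.
Qed.

Lemma norm_mxX_le d (A : 'M[R]_d) k : `|A ^+ k| <= (d%:R * `|A|) ^+ k.
Proof.
apply: mx_norm_le => [|i j]; last exact: expmx_entry_le.
by rewrite exprn_ge0 ?mulr_ge0.
Qed.

Lemma norm_trmx p q (A : 'M[R]_(p, q)) : `|A^T| = `|A|.
Proof.
apply/eqP; rewrite eq_le; apply/andP; split; apply: mx_norm_le => // i j.
  by rewrite mxE mx_entry_le.
by have := mx_entry_le A^T j i; rewrite mxE.
Qed.

Lemma cvg_mx_of_entries (T : Type) (F : set_system T)
    {FF : Filter F} p q (f : T -> 'M[R]_(p, q)) (L : 'M[R]_(p, q)) :
  (forall i j, f t i j @[t --> F] --> L i j) -> f t @[t --> F] --> L.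
Proof.
move=> fL A [P PL sPA].
suff : \forall t \near F, forall i j, P i j (f t i j).
  by apply: filterS => t Pt; exact: sPA.
apply: filter_forall => i; apply: filter_forall => j.
exact: (fL i j _ (PL i j)).
Qed.

Lemma cvg_mulmx p q r (u : nat -> 'M[R]_(p, q)) (v : nat -> 'M[R]_(q, r))
    (A : 'M[R]_(p, q)) (B : 'M[R]_(q, r)) :
  u @ \oo --> A -> v @ \oo --> B -> (fun n => u n *m v n) @ \oo --> A *m B.
Proof.
move=> uA vB; apply: cvg_mx_entries => i j; rewrite mxE.
under eq_fun do rewrite mxE.
apply: cvg_big => [|l _]; first exact: add_continuous.
by apply: cvgM; exact: cvg_entry.
Qed.

Lemma mulmx_continuous p q r (A : 'M[R]_(p, q)) :
  continuous (mulmx A : 'M[R]_(q, r) -> 'M[R]_(p, r)).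
Proof.
apply: bounded_linear_continuous; apply/linear_boundedP.
near=> k => B; apply: (le_trans (norm_mulmx_le _ _)).
by apply: ler_wpM2r => //; near: k; apply: nbhs_pinfty_ge; rewrite num_real.
Unshelve. all: by end_near. Qed.

Lemma trmx_continuous p q : continuous (trmx : 'M[R]_(p, q) -> 'M[R]_(q, p)).
Proof.
apply: bounded_linear_continuous; apply/linear_boundedP.
by near=> k => B; rewrite norm_trmx ler_peMl.
Unshelve. all: by end_near. Qed.

(** The ball is compact: it is the image under transposition of a ball of row
    vectors, to which the Heine-Borel theorem applies. *)
Lemma bounded_on_ball d (W : normedModType R) (G : 'cV[R]_d -> W) (r : R) :
  continuous G -> exists2 M : R, 0 <= M & forall x, `|x| <= r -> `|G x| <= M.
Proof.
move=> cG; pose K := [set w : 'rV[R]_d | `|w| <= r].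
have cK : compact K.
  apply: bounded_closed_compact.
    exists r; split; first by rewrite num_real.
    by move=> t rt w /le_trans; apply; exact: ltW.
  rewrite (_ : K = Num.norm @^-1` [set t : R | t <= r])//.
  by apply: closed_comp => [w _|]; [exact: norm_continuous|exact: closed_le].
have : compact ((G \o trmx) @` K).
  apply: continuous_compact => //; apply: continuous_subspaceT => w.
  by apply: continuous_comp; [exact: trmx_continuous|exact: cG].
move=> /compact_bounded /ex_strict_bound_gt0[M M0 GM].
exists M => [|x xr]; first exact: ltW.
apply/ltW/GM; exists x^T; last by rewrite /= trmxK.
by rewrite /K /= norm_trmx.
Qed.

End MatrixNorm.

(** * Norm estimates for power series of a matrix *)

Section PowerSeries.
Context {R : realType} {d : nat}.
Implicit Types (A : 'M[R]_d) (c : nat -> R).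

Lemma series_exp_coeff_le (x : R) n :
  0 <= x -> series (exp_coeff x) n <= expR x.
Proof.
move=> x0; apply: nondecreasing_cvgn_le; last exact: is_cvg_series_exp_coeff.
by apply: nondecreasing_series => k _ _; exact: exp_coeff_ge0.
Qed.

Lemma norm_mx_term_le c A k : `|c k| <= (k`!%:R)^-1 ->
  `|c k *: A ^+ k| <= exp_coeff (d%:R * `|A|) k.
Proof.
by move=> ck; rewrite normrZ /exp_coeff /= mulrC ler_pM// norm_mxX_le.
Qed.

(** The terms of degree at least one are dominated by those of the exponential
    series of [d * |A|], which sum to [expR (d * |A|) - 1]. *)
Lemma norm_mx_series_sub_le c A : (forall k, `|c k| <= (k`!%:R)^-1) ->
  `|limn (series (fun k => c k *: A ^+ k)) - (c 0)%:M|
    <= expR (d%:R * `|A|) - 1.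
Proof.
move=> c_le; set s := series _.
have cs : s @ \oo --> limn s by exact: is_cvg_mx_series.
have b0 : 0 <= d%:R * `|A| by rewrite mulr_ge0.
have cn : (fun n => `|s n - (c 0)%:M|) @ \oo --> `|limn s - (c 0)%:M|.
  by apply: cvg_norm; apply: cvgB => //; exact: cvg_cst.
rewrite -(cvg_lim _ cn)//; apply: limr_le.
  by apply/cvg_ex; eexists; exact: cn.
exists 1 => // -[//|n] _ /=.
rewrite /s /series /= big_nat_recl// expr0 scalemx1 addrAC subrr add0r.
rewrite (le_trans (ler_norm_sum _ _ _))// lerBrDl.
apply: le_trans (series_exp_coeff_le n.+1 b0).
rewrite /series /= [leRHS]big_nat_recl// /exp_coeff /= expr0 fact0 divr1 lerD2l.
by apply: ler_sum => k _; exact: norm_mx_term_le.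
Qed.

Lemma norm_inv_factS_le k : `|(k.+1)`!%:R^-1| <= k`!%:R^-1 :> R.
Proof.
rewrite ger0_norm ?invr_ge0//.
by rewrite lef_pV2 ?posrE ?ltr0n ?fact_gt0// ler_nat factS leq_pmull.
Qed.

Lemma norm_phi1m_sub1_le A : `|phi1m A - 1%:M| <= expR (d%:R * `|A|) - 1.
Proof.
have := @norm_mx_series_sub_le (fun k => (k.+1)`!%:R^-1) A.
by rewrite factS fact0 muln1 invr1; apply; exact: norm_inv_factS_le.
Qed.

Lemma norm_phi1m_le A : `|phi1m A| <= expR (d%:R * `|A|).
Proof.
rewrite -(subrK 1%:M (phi1m A)) (le_trans (ler_normD _ _))// -lerBrDr.
by rewrite (le_trans (norm_phi1m_sub1_le A))// lerD2l lerN2 norm_mx1_le.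
Qed.

End PowerSeries.

(** * The Cauchy product and the functional equations of exp and phi_1 *)

(** The square [0, n) x [0, n) is cut along its antidiagonal: the indices with
    [i + j < n], collected by the value [m] of [i + j], are those of a partial
    Cauchy product; the others form the remainder. *)
Lemma sum_square_diag (V : zmodType) (f : nat -> nat -> V) n :
  \sum_(0 <= i < n) \sum_(0 <= j < n) f i j =
  \sum_(0 <= m < n) \sum_(0 <= i < m.+1) f i (m - i)%N +
  \sum_(0 <= i < n) \sum_(n - i <= j < n) f i j.
Proof.
have -> : \sum_(0 <= m < n) \sum_(0 <= i < m.+1) f i (m - i)%N =
          \sum_(0 <= i < n) \sum_(0 <= j < n - i) f i j.
  have -> : \sum_(0 <= m < n) \sum_(0 <= i < m.+1) f i (m - i)%N =
            \sum_(0 <= m < n) \sum_(0 <= i < n | (i < m.+1)%N) f i (m - i)%N.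
    apply: eq_big_nat => m /andP[_ mn].
    by rewrite [LHS](big_nat_widen _ _ n).
  rewrite (exchange_big_dep_nat xpredT)//=.
  apply: eq_big_nat => i _.
  rewrite -[RHS]/(\sum_(0 <= j < n - i | true) f i j).
  under [RHS]eq_bigr => j _ do rewrite -{1}(addnK i j).
  rewrite -(big_addn 0 n i xpredT (fun m => f i (m - i)%N)) add0n.
  by rewrite [RHS](@big_nat_widenl _ _ _ _ 0)//.
rewrite -big_split; apply: eq_big_nat => i /andP[_ ltin] /=.
by rewrite -big_cat_nat ?leq_subr.
Qed.

Lemma exp_coeffD (R : realType) (x y : R) n :
  exp_coeff (x + y) n =
  \sum_(0 <= i < n.+1) exp_coeff x i * exp_coeff y (n - i)%N.
Proof.
rewrite /exp_coeff /= addrC exprDn big_mkord mulr_suml.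
apply: eq_bigr => i _; have le_in : (i <= n)%N by rewrite -ltnS.
have fact_neq0 k : k`!%:R != 0 :> R by rewrite pnatr_eq0 -lt0n fact_gt0.
rewrite -(bin_fact le_in) !natrM -[_ *+ 'C(n, i)]mulr_natl.
have C_neq0 : 'C(n, i)%:R != 0 :> R by rewrite pnatr_eq0 -lt0n bin_gt0.
by field; rewrite ?fact_neq0 ?C_neq0.
Qed.

(** The remainder of the Cauchy product is dominated, term by term, by the
    remainder of the Cauchy product of the scalar exponential series at
    [x = d * |A|] with itself.  The latter is the difference between the square
    of a partial sum at [x] and a partial sum at [x + x], and it tends to
    [expR x * expR x - expR (x + x) = 0]. *)
Lemma mx_cauchy_product (R : realType) d (A : 'M[R]_d) (a b : nat -> R) :
  (forall k, `|a k| <= (k`!%:R)^-1) -> (forall k, `|b k| <= (k`!%:R)^-1) ->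
  series (fun m => (\sum_(0 <= i < m.+1) a i * b (m - i)%N) *: A ^+ m) @ \oo -->
  limn (series (fun k => a k *: A ^+ k)) *m
  limn (series (fun k => b k *: A ^+ k)).
Proof.
move=> a_le b_le; set c := series _.
set sa := series (fun k => a k *: A ^+ k).
set sb := series (fun k => b k *: A ^+ k).
pose x := d%:R * `|A|; pose e := exp_coeff x.
have cab : (fun n => sa n *m sb n) @ \oo --> limn sa *m limn sb.
  by apply: cvg_mulmx; exact: is_cvg_mx_series.
suff : (fun n => sa n *m sb n - c n) @ \oo --> (0 : 'M[R]_d).
  move=> /(cvgB cab); rewrite subr0; apply: cvg_trans; apply: near_eq_cvg.
  by near=> n; rewrite /= opprB addrC subrK.
have diffE n : sa n *m sb n - c n =
    \sum_(0 <= i < n) \sum_(n - i <= j < n) (a i * b j) *: A ^+ (i + j).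
  have -> : sa n *m sb n =
      \sum_(0 <= i < n) \sum_(0 <= j < n) (a i * b j) *: A ^+ (i + j).
    rewrite /sa /sb /series /= mulmx_suml; apply: eq_bigr => i _.
    rewrite mulmx_sumr; apply: eq_bigr => j _.
    by rewrite -scalemxAl -scalemxAr scalerA exprD.
  rewrite sum_square_diag [X in X + _ - _](_ : _ = c n).
    by rewrite addrC addKr.
  rewrite /c /series /=; apply: eq_bigr => m _; rewrite scaler_suml.
  by apply: eq_big_nat => i /andP[_]; rewrite ltnS => im; rewrite subnKC.
apply: norm_cvg0.
apply: (@squeeze_cvgr _ _ _ _ (cst 0)
  (fun n => series e n * series e n - series (exp_coeff (x + x)) n)).
- near=> n; rewrite normr_ge0 /= diffE.
  have -> : series e n * series e n - series (exp_coeff (x + x)) n =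
      \sum_(0 <= i < n) \sum_(n - i <= j < n) e i * e j.
    have -> : series e n * series e n =
        \sum_(0 <= i < n) \sum_(0 <= j < n) e i * e j.
      by rewrite /series /= mulr_suml; apply: eq_bigr => i _; rewrite mulr_sumr.
    rewrite sum_square_diag /series /=.
    under [X in _ - X]eq_bigr do rewrite exp_coeffD.
    by rewrite addrAC subrr add0r.
  rewrite (le_trans (ler_norm_sum _ _ _))//; apply: ler_sum => i _.
  rewrite (le_trans (ler_norm_sum _ _ _))//; apply: ler_sum => j _.
  rewrite /e /exp_coeff /= mulrACA -exprD normrZ normrM [leRHS]mulrC.
  rewrite ler_pM ?mulr_ge0 ?norm_mxX_le//.
  by rewrite ler_pM ?a_le ?b_le.
- exact: cvg_cst.
- have -> : 0 = expR x * expR x - expR (x + x) by rewrite expRD subrr.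
  apply: cvgB; last exact: is_cvg_series_exp_coeff.
  by apply: cvgM; exact: is_cvg_series_exp_coeff.
Unshelve. all: by end_near. Qed.

(** By the Cauchy product the claim is the coefficient identity
    1/(m+1)! = sum over i <= m of (-1)^(m-i) / (i! (m+1-i)!), which is the
    vanishing of the coefficient of degree m+1 in e^z e^(-z) = 1. *)
Lemma expm_mul_phi1mN (R : realType) d (A : 'M[R]_d) :
  expm A *m phi1m (- A) = phi1m A.
Proof.
pose a k : R := (k`!%:R)^-1; pose b k : R := (-1) ^+ k * ((k.+1)`!%:R)^-1.
have phiN : phi1m (- A) = limn (series (fun k => b k *: A ^+ k)).
  congr (limn (series _)); apply/funext => k.
  rewrite exprNn /b -2!(signr_odd _ k).
  by case: (odd k); rewrite ?expr1 ?expr0 ?mulN1r ?mul1r// scaleNr scalerN.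
have ab m : \sum_(0 <= i < m.+1) a i * b (m - i)%N = ((m.+1)`!%:R)^-1.
  (* The last summand, i = m + 1, is the inverse factorial to be isolated. *)
  have := exp_coeffD 1 (- 1 : R) m.+1.
  rewrite subrr big_nat_recr//= subnn /exp_coeff /= expr0n/= mul0r.
  rewrite !expr1n expr0 fact0 divr1 mulr1 mul1r => /esym/eqP.
  rewrite addr_eq0 => /eqP/(congr1 -%R); rewrite opprK -sumrN => <-.
  apply: eq_big_nat => i /andP[_]; rewrite ltnS => im.
  by rewrite /a /b subSn// expr1n exprS mul1r !mulN1r mulNr mulrN opprK.
have aA k : `|a k| <= (k`!%:R)^-1 by rewrite ger0_norm ?invr_ge0.
have bA k : `|b k| <= (k`!%:R)^-1.
  by rewrite normrM normrX normrN1 expr1n mul1r norm_inv_factS_le.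
have := mx_cauchy_product (A := A) aA bA; rewrite -phiN => cvp.
rewrite -[LHS](cvg_lim _ cvp)//; congr (limn (series _)).
by apply/funext => m; rewrite ab.
Qed.

(** Substituting e^(-A) = I - A phi_1(-A) reduces the product to
    e^A - phi_1(A) A, which is I. *)
Lemma expm_mulN (R : realType) d (A : 'M[R]_d) : expm A *m expm (- A) = 1%:M.
Proof.
rewrite -[expm (- A)](subrK 1%:M) -phi1mE mulmxDr mulmx1 mulmxA expm_mul_phi1mN.
by rewrite mulmxN phi1mE opprB subrK.
Qed.

(** * The Jacobi matrix *)

Section Jacobi.
Context {R : realType} {d : nat}.
Implicit Types F : 'cV[R]_d -> 'cV[R]_d.

Lemma jacobiE F x i j : differentiable F x ->
  jacobi F x i j = 'D_(delta_mx j ord0) F x i ord0.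
Proof.
by move=> dF; rewrite mxE derive_mx ?mxE//; exact: diff_derivable.
Qed.

Lemma diff_jacobi F x v : differentiable F x -> 'd F x v = jacobi F x *m v.
Proof.
move=> dF; rewrite [v in LHS]matrix_sum_delta linear_sum.
apply/colP => i; rewrite mxE summxE; apply: eq_bigr => j _.
by rewrite big_ord1 linearZ mxE mulrC jacobiE// deriveE.
Qed.

Lemma jacobi_continuous F : (forall x, differentiable F x) ->
  (forall j : 'I_d, continuous ('D_(delta_mx j ord0) F)) ->
  continuous (jacobi F).
Proof.
move=> dF cDF x; apply: (@cvg_mx_of_entries _ _ (nbhs x)) => i j.
under eq_fun do rewrite jacobiE//; rewrite jacobiE//.
exact: (cvg_comp _ _ (cDF j x) (@coord_continuous _ _ _ i ord0 _)).
Qed.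

End Jacobi.

(** * The modified implicit Euler scheme *)

Section ModifiedEuler.
Context {R : realType} {d : nat}.
Implicit Types (F : 'cV[R]_d -> 'cV[R]_d) (A : 'M[R]_d).

Lemma one_sub_exp_div_mul (h : R) A :
  one_sub_exp_div h A *m A = 1%:M - expm (- (h *: A)).
Proof.
have := phi1mE (- (h *: A)).
rewrite mulmxN -scalemxAr /one_sub_exp_div -scalemxAl => /(congr1 -%R).
by rewrite opprK opprB.
Qed.

Lemma expm_mul_one_sub_exp_div (h : R) A :
  expm (h *: A) *m one_sub_exp_div h A = h *: phi1m (h *: A).
Proof. by rewrite /one_sub_exp_div -scalemxAr expm_mul_phi1mN. Qed.

Lemma norm_one_sub_exp_div_le (h : R) A :
  `|one_sub_exp_div h A| <= `|h| * expR (d%:R * (`|h| * `|A|)).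
Proof.
by rewrite normrZ ler_wpM2l// -normrZ -[`|h *: A|]normrN norm_phi1m_le.
Qed.

Lemma one_sub_exp_div_step F :
  step_modification (fun x h => one_sub_exp_div h (jacobi F x)).
Proof.
move=> x; set A := jacobi F x.
apply/subr_cvg0; apply: norm_cvg0.
have : d%:R * (`|h| * `|A|) @[h --> (0 : R)^'] --> d%:R * (`|0 : R| * `|A|).
  by apply: cvgMl_tmp; apply: cvgMr_tmp; apply: cvg_norm; exact: nbhs_dnbhs.
rewrite normr0 mul0r mulr0 => cvg_arg.
have : expR (d%:R * (`|h| * `|A|)) - 1 @[h --> (0 : R)^'] --> expR 0 - 1.
  apply: cvgB; last exact: cvg_cst.
  by apply: continuous_cvg => //; exact: continuous_expR.
rewrite expR0 subrr => cvg_bound.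
apply: (squeeze_cvgr _ (cvg_cst 0) cvg_bound).
near=> h; rewrite normr_ge0/=.
have h0 : h != 0 by near: h; exact: nbhs_dnbhs_neq.
rewrite scalerA mulVf// scale1r -normrZ -[`|h *: A|]normrN.
exact: norm_phi1m_sub1_le.
Unshelve. all: by end_near. Qed.

(** The linearized scheme is e^(-hA) nu = mu + D F(x), and e^(hA) both inverts
    the left-hand factor and turns D into h phi_1(hA). *)
Lemma modified_euler_exact_at F x (h : R) : differentiable F x ->
  locally_exact_at F
    (modified_implicit_euler F (fun x h => one_sub_exp_div h (jacobi F x))) x h.
Proof.
move=> dF; set A := jacobi F x; set D := one_sub_exp_div h A.
pose S (p : 'cV[R]_d * 'cV[R]_d) := (p.2 - p.1) - D *m F p.2.
have dS : is_diff (x, x) S (fun q => (q.2 - q.1) - D *m (A *m q.2)).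
  have d1 : is_diff (x, x) (fst : 'cV[R]_d * 'cV[R]_d -> _) fst.
    by apply: DiffDef;
      [apply: linear_differentiable|apply: diff_lin] => p; exact: cvg_fst.
  have d2 : is_diff (x, x) (snd : 'cV[R]_d * 'cV[R]_d -> _) snd.
    by apply: DiffDef;
      [apply: linear_differentiable|apply: diff_lin] => p; exact: cvg_snd.
  have dFx : is_diff x F (mulmx A).
    by apply: DiffDef => //; apply/funext => v; exact: diff_jacobi.
  have dD : is_diff (F x) (mulmx D : 'cV[R]_d -> 'cV[R]_d) (mulmx D).
    by apply: DiffDef;
      [apply: linear_differentiable|apply: diff_lin]; exact: mulmx_continuous.
  exact: (is_diffB (is_diffB d2 d1)
    (is_diff_comp (is_diff_comp d2 dFx) dD)).
split; first by case: dS.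
move=> mu nu; rewrite /linearization -/S diff_val /S /modified_implicit_euler /=.
rewrite subrr sub0r mulmxA one_sub_exp_div_mul mulmxBl mul1mx.
set E := expm (- (h *: A)).
have EK : expm (h *: A) *m E = 1%:M by exact: expm_mulN.
have KE : E *m expm (h *: A) = 1%:M.
  by rewrite -[X in _ *m expm X]opprK; exact: expm_mulN.
have -> : - (D *m F x) + (nu - mu - (nu - E *m nu)) =
    E *m nu - (mu + D *m F x).
  by rewrite opprB [nu - mu + _]addrC subrKA addrC opprD addrA.
have -> : exact_step F x h mu = expm (h *: A) *m (mu + D *m F x).
  by rewrite mulmxDr mulmxA expm_mul_one_sub_exp_div -scalemxAl.
split=> [/subr0_eq <-|->]; first by rewrite mulmxA EK mul1mx.
by rewrite mulmxA KE mul1mx subrr.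
Qed.

(** In D = h phi_1(-hA) the factor h is explicit, and phi_1(-hA) is bounded
    uniformly because |hA| <= H * MJ, where MJ bounds the Jacobi matrix on the
    ball.  At the right endpoint y this controls x_(n+1) - x_n. *)
Lemma modified_euler_increment_le F (r H : R) :
  continuous F -> continuous (jacobi F) ->
  exists C, forall h y, 0 < h <= H -> `|y| <= r ->
    `|one_sub_exp_div h (jacobi F y) *m F y| <= C * h.
Proof.
move=> cF cJ.
have [MF MF0 F_le] := bounded_on_ball r cF.
have [MJ MJ0 J_le] := bounded_on_ball r cJ.
exists (d%:R * expR (d%:R * (H * MJ)) * MF) => h y /andP[h0 hH] yr.
rewrite (le_trans (norm_mulmx_le _ _))//.
rewrite [leRHS]mulrAC ler_pM ?mulr_ge0 ?F_le// -mulrA ler_wpM2l//.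
rewrite (le_trans (norm_one_sub_exp_div_le _ _))// gtr0_norm// mulrC.
rewrite ler_wpM2r ?(ltW h0)// ler_expR ler_wpM2l//.
by rewrite ler_pM// ?(ltW h0)// J_le.
Qed.

End ModifiedEuler.

Theorem proposition3p3 (R : realType) (d : nat) (F : 'cV[R]_d -> 'cV[R]_d)
    (smooth_F : smooth F) :
  let delta := fun (xbar : 'cV[R]_d) (h : R) =>
    one_sub_exp_div h (jacobi F xbar) in
  let S := modified_implicit_euler F delta in
  let left_point := fun x y : 'cV[R]_d => x in
  let right_point := fun x y : 'cV[R]_d => y in
  step_modification delta /\
  ((forall (N : nat) (h : nat -> R) (x : nat -> 'cV[R]_d),
      run S left_point N h x <->
      forall n, (n < N)%N -> 0 < h n /\
        x n.+1 = x n
          + one_sub_exp_div (h n) (jacobi F (x n)) *m F (x n.+1)) /\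
   locally_exact F S left_point) /\
  ((forall (N : nat) (h : nat -> R) (x : nat -> 'cV[R]_d),
      run S right_point N h x <->
      forall n, (n < N)%N -> 0 < h n /\
        x n.+1 = x n
          + one_sub_exp_div (h n) (jacobi F (x n.+1)) *m F (x n.+1)) /\
   locally_exact F S right_point).
Proof.
move=> delta S left_point right_point.
have [dF cDF] := smooth_F 1; have cF := smooth_F 0.
have cJ : continuous (jacobi F) by exact: jacobi_continuous.
have schemeP xbar h x y :
    S xbar h x y = 0 <-> y = x + delta xbar h *m F y.
  rewrite /S /modified_implicit_euler.
  split=> [/subr0_eq <-|yE]; first by rewrite addrC subrK.
  by rewrite {1}yE [x + _]addrC addrK subrr.
have runP choice N h x : run S choice N h x <->
    forall n, (n < N)%N -> 0 < h n /\
    x n.+1 = x n + delta (choice (x n) (x n.+1)) (h n) *m F (x n.+1).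
  by split=> Sx n /Sx[h0 /schemeP].
split; first exact: one_sub_exp_div_step.
split; (split; first by move=> N h x; exact: runP).
  split=> [r H|h x _ n]; last exact: modified_euler_exact_at.
  by exists 0 => N h x _ _ _ n _; rewrite subrr normr0 mul0r.
split=> [r H|h x _ n]; last exact: modified_euler_exact_at.
have [C C_le] := modified_euler_increment_le r H cF cJ.
exists C => N h x /runP Sx xr hH n nN; have [h0 xE] := Sx n nN.
rewrite /right_point {1}xE addrC addKr.
by apply: C_le; rewrite ?h0 ?hH ?xr.
Qed.
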